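(* Let $K(m)$ be the cell-centered finite volume matrix defined in the context, let $b=(b_H,b_L)$ be a right-hand side independent of $m$, and let $x(m)=(x_H(m),x_L(m))$ be the solution of $K(m)x(m)=b$. Let $e_H$ be the constant vector on $H$. Then, as $m\to\infty$, $$x_H(m)=c_H\,e_H+\mathcal{O}(m^{-1}),$$ where the scalar $c_H$ is determined by the solution in the lowly-diffusive region.
   Context: Grid and coefficient. The unit square $\Omega$ is divided into a fixed uniform $N\times N$ grid of square cells, one unknown per cell. Two cells are adjacent if they share an edge. The set of cells is partitioned as $H\cup L$ (disjoint), where $H$ is a nonempty edge-connected set of cells (the highly-diffusive island) none of which has an edge on $\partial\Omega$, and $L$ is the lowly-diffusive region. For $m\ge 1$ let $\alpha_p=m$ if $p\in H$ and $\alpha_p=1$ if $p\in L$. Matrix. $K(m)$ is the symmetric positive definite matrix of the 5-point conservative finite volume discretization (harmonic averaging) of $-\nabla\cdot(\alpha\nabla u)=f$ with $u=0$ on $\partial\Omega$: for adjacent cells $p\neq q$, $[K(m)]_{pq}=-\frac{2\alpha_p\alpha_q}{\alpha_p+\alpha_q}$; for non-adjacent $p\ne q$, $[K(m)]_{pq}=0$; and $[K(m)]_{pp}=\sum_{q\text{ adjacent to }p}\frac{2\alpha_p\alpha_q}{\alpha_p+\alpha_q}+2\alpha_p\cdot\#\{\text{edges of }p\text{ on }\partial\Omega\}$. Thus the $H$–$H$ coupling is $m$, the $L$–$L$ coupling is $1$, and the $H$–$L$ coupling is $\frac{2m}{m+1}$. Vectors are split according to $H\cup L$; $x_H(m)$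 and $x_L(m)$ are the parts of the solution on the highly-diffusive and lowly-diffusive regions. The vector $e_H$ has all entries equal to $n_H^{-1/2}$, where $n_H=|H|$. The scalar $c_H$ does not depend on $m$. Implied constants in $\mathcal O$ are independent of $m$. *)

(* Defs.v *)
From mathcomp Require Import all_boot all_order all_algebra.
From mathcomp Require Import all_classical all_reals all_analysis.

Set Implicit Arguments.
Unset Strict Implicit.
Unset Printing Implicit Defensive.

Import Order.TTheory GRing.Theory Num.Theory.
Import numFieldNormedType.Exports.

Local Open Scope ring_scope.

(* Lets the Landau notations be used along m -> +oo. *)
Canonical pinfty_filter_on (R : numFieldType) :=
  FilterType (pinfty_nbhs R) proper_pinfty_nbhs.

Definition cell (N : nat) : finType := ('I_N * 'I_N)%type.

Definition cell_adj (N : nat) : rel (cell N) := fun p q =>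
  ((p.1 == q.1) && ((p.2.+1 == q.2 :> nat) || (q.2.+1 == p.2 :> nat))) ||
  ((p.2 == q.2) && ((p.1.+1 == q.1 :> nat) || (q.1.+1 == p.1 :> nat))).

(* A cell has four edges, so a cell may have several of them on the boundary of
   the square; for N = 1 all four are. *)
Definition boundary_edges (N : nat) (p : cell N) : nat :=
  ((p.1 == 0 :> nat) + (p.1.+1 == N) + (p.2 == 0 :> nat) + (p.2.+1 == N))%N.

Definition edge_connected (N : nat) (H : {set cell N}) : Prop :=
  {in H &, forall p q,
    connect (fun a c => [&& a \in H, c \in H & cell_adj a c]) p q}.

(* The lowly-diffusive region L is ~: H. *)
Definition alpha (R : realType) (N : nat) (H : {set cell N}) (m : R)
  (p : cell N) : R := if p \in H then m else 1.

Definition hmean (R : realType) (a c : R) : R := 2 * a * c / (a + c).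

Definition coupling (R : realType) (N : nat) (H : {set cell N}) (m : R)
  (p q : cell N) : R := hmean (alpha H m p) (alpha H m q).

Definition K_entry (R : realType) (N : nat) (H : {set cell N}) (m : R)
  (p q : cell N) : R :=
  if p == q then
    \sum_(r | cell_adj p r) coupling H m p r
      + 2 * alpha H m p * (boundary_edges p)%:R
  else if cell_adj p q then - coupling H m p q else 0.

(* Unknowns are numbered through the canonical enumeration of the finite type
   of cells; the numbering is immaterial. *)
Definition K (R : realType) (N : nat) (H : {set cell N}) (m : R) :
  'M[R]_#|cell N| :=
  \matrix_(i, j) K_entry H m (enum_val i) (enum_val j).

Definition part (R : realType) (N : nat) (A : {set cell N})
  (v : 'cV[R]_#|cell N|) : 'cV[R]_#|A| :=
  \col_i v (enum_rank (enum_val i)) 0.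

Definition e_ (R : realType) (N : nat) (H : {set cell N}) : 'cV[R]_#|H| :=
  const_mx (Num.sqrt #|H|%:R)^-1.

(* Limit as m -> +oo of the H-L block of K H m: the coupling 2m/(m+1) across
   the interface tends to 2. *)
Definition K_HL_lim (R : realType) (N : nat) (H : {set cell N}) :
  'M[R]_(#|H|, #|~: H|) :=
  \matrix_(i, j) (if cell_adj (enum_val i) (enum_val j) then - 2 else 0).

Definition interface_edges (N : nat) (H : {set cell N}) : nat :=
  #|[set pq : cell N * cell N |
      [&& pq.1 \in H, pq.2 \notin H & cell_adj pq.1 pq.2]]|.

(* Limit as m -> +oo of e_H^T K_HH(m) e_H, which is
   2m/(m+1) * interface_edges H / #|H| when H has no edge on the boundary. *)
Definition eta (R : realType) (N : nat) (H : {set cell N}) : R :=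
  2 * (interface_edges H)%:R / #|H|%:R.

(* The coefficient along e_H that a lowly-diffusive solution xL forces on the
   island: summing the island equations eliminates the couplings of size m, and
   the limiting balance is  eta * c = e_H^T (b_H - K_HL_lim xL). *)
Definition island_coefficient (R : realType) (N : nat) (H : {set cell N})
  (bH : 'cV[R]_#|H|) (xL : 'cV[R]_#|~: H|) : R :=
  (eta R H)^-1 * ((e_ R H)^T *m (bH - K_HL_lim R H *m xL)) 0 0.

(* Main.v *)
(* Each entry of x(m) is, by Cramer's rule, a rational function of m, and the
   energy identity together with a discrete Poincare inequality bounds it
   uniformly in m >= 1. A bounded rational function has a limit l with error
   O(1/m). The energy bound also gives m (x_p - x_q)^2 = O(1) across edges
   inside H, so l is constant on the connected set H. Summing the equations over
   H cancels the couplings of size m and leaves the flux balance across the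
   interface, which determines that constant from the values of l on L. *)
Require Import Defs.
From mathcomp Require Import all_boot all_order all_algebra.
From mathcomp Require Import all_classical all_reals all_analysis.
From mathcomp Require Import ring lra.
Import Order.TTheory GRing.Theory Num.Theory.
Import numFieldNormedType.Exports.
Local Open Scope classical_set_scope.
Local Open Scope ring_scope.

(** * Bounded rational functions of a large argument *)

Lemma horner_leading_term (R : realType) (P : {poly R}) (n : nat) (m : R) :
  (size P <= n.+1)%N -> 1 <= m ->
  `|P.[m] / m ^+ n - P`_n| <= (\sum_(i < n) `|P`_i|) / m.
Proof.
move=> sP m1; have m0 : 0 < m by exact: lt_le_trans m1.
rewrite (horner_coef_wide _ sP) big_ord_recr /= mulrDl mulfK; last first.
  by rewrite expf_neq0// gt_eqF.
rewrite addrK !mulr_suml (le_trans (ler_norm_sum _ _ _))// ler_sum// => i _.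
rewrite !normrM -mulrA ler_wpM2l// ger0_norm ?exprn_ge0 ?(ltW m0)//.
rewrite ger0_norm ?invr_ge0 ?exprn_ge0 ?(ltW m0)//.
rewrite ler_pdivrMr ?exprn_gt0// mulrC.
rewrite ler_pdivlMr// -exprSr ler_weXn2l//.
Qed.

Lemma eq0_of_bounded_multiples (R : realType) (a D : R) :
  (forall m, 1 <= m -> `|a| <= D / m) -> a = 0.
Proof.
move=> aD; apply/eqP; rewrite -normr_eq0; apply: contraT => a0.
have {}a0 : 0 < `|a| by rewrite lt_neqAle eq_sym a0 normr_ge0.
have D0 : 0 <= D by have := aD 1 (lexx _); lra.
have k0 : 0 <= D / `|a| by rewrite divr_ge0// ltW.
(* At this value of [m] the bound reads [D + |a| <= D]. *)
have := aD (D / `|a| + 1); rewrite lerDr => /(_ k0).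
rewrite ler_pdivlMr ?ltr_wpDl// mulrDr mulrCA divff ?gt_eqF//; lra.
Qed.

(** After division by [m ^+ n], with [n] the larger of the two degrees, [P] and [Q] tend to their
    coefficients of index [n] at rate [1/m]. The limit is the quotient of these coefficients. *)
Lemma bounded_rational_limit (R : realType) (P Q : {poly R}) (f : R -> R)
    (B : R) :
  Q != 0 ->
  (forall m, 1 <= m -> P.[m] = Q.[m] * f m) ->
  (forall m, 1 <= m -> `|f m| <= B) ->
  exists l D : R, forall m, 1 <= m -> `|f m - l| <= D / m.
Proof.
move=> Q0 PQf fB.
have B0 : 0 <= B by rewrite (le_trans _ (fB 1 (lexx _))).
pose n := (maxn (size P) (size Q)).-1.
have sn : maxn (size P) (size Q) = n.+1.
  by rewrite prednK// leq_max [X in _ || X]size_poly_gt0 Q0 orbT.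
have sP : (size P <= n.+1)%N by rewrite -sn leq_maxl.
have sQ : (size Q <= n.+1)%N by rewrite -sn leq_maxr.
pose C1 : R := \sum_(i < n) `|P`_i|; pose C2 : R := \sum_(i < n) `|Q`_i|.
have key m : 1 <= m -> `|Q`_n * f m - P`_n| <= (C1 + C2 * B) / m.
  move=> m1; have := horner_leading_term R P n m sP m1.
  have := horner_leading_term R Q n m sQ m1; rewrite -/C1 -/C2 PQf//.
  set q' := Q.[m] / m ^+ n => hq; rewrite mulrAC -/q' => hp.
  (* The error in [Q] gets multiplied by [f m], so the bound [B] enters here. *)
  have -> : Q`_n * f m - P`_n = (q' * f m - P`_n) - (q' - Q`_n) * f m by ring.
  rewrite (le_trans (ler_normB _ _))// [leRHS]mulrDl lerD// normrM mulrAC.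
  by apply: ler_pM => //; exact: fB.
(* If this coefficient vanished, [key] would force that of [P] to vanish too, yet one of them is a
   leading coefficient by the choice of [n]. *)
have qn0 : Q`_n != 0.
  apply/eqP => qn0.
  have pn0 : P`_n = 0.
    apply: (@eq0_of_bounded_multiples _ _ (C1 + C2 * B)) => m /key.
    by rewrite qn0 mul0r sub0r normrN.
  have [sPQ|sPQ] := leqP (size P) (size Q).
    move: sn; rewrite (maxn_idPr sPQ) => sn.
    by move: Q0; rewrite -lead_coef_eq0 lead_coefE sn qn0 eqxx.
  move: sn; rewrite (maxn_idPl (ltnW sPQ)) => sn.
  have : P != 0 by rewrite -size_poly_gt0 sn.
  by rewrite -lead_coef_eq0 lead_coefE sn pn0 eqxx.
exists (P`_n / Q`_n); exists ((C1 + C2 * B) / `|Q`_n|) => m m1.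
rewrite mulrAC ler_pdivlMr ?normr_gt0// -normrM mulrBl mulfVK// mulrC.
exact: key.
Qed.

(** * The stencil, its energy and bounds uniform in [m] *)

Section Stencil.
Context (R : realType) (N : nat) (H : {set cell N}).
Implicit Types (m : R) (u : cell N -> R) (p q : cell N).

Definition stencil m u p : R :=
  \sum_(q | cell_adj p q) coupling H m p q * (u p - u q)
  + 2 * alpha H m p * (boundary_edges p)%:R * u p.

Definition energy m u : R :=
  2^-1 * (\sum_p \sum_(q | cell_adj p q) coupling H m p q * (u p - u q) ^+ 2)
  + \sum_p 2 * alpha H m p * (boundary_edges p)%:R * u p ^+ 2.

Lemma cell_adjC p q : cell_adj p q = cell_adj q p.
Proof.
by rewrite /cell_adj [p.1 == _]eq_sym [p.2 == _]eq_sym; congr orb;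
  rewrite orbC.
Qed.

Lemma cell_adjxx p : cell_adj p p = false.
Proof. by rewrite /cell_adj !eqxx /= !eqn_leq !ltnn. Qed.

Lemma couplingC m p q : coupling H m p q = coupling H m q p.
Proof. by rewrite /coupling /hmean; congr (_ / _); ring. Qed.

Lemma alpha_ge1 m p : 1 <= m -> 1 <= alpha H m p.
Proof. by rewrite /alpha; case: ifP. Qed.

Lemma coupling_ge1 m p q : 1 <= m -> 1 <= coupling H m p q.
Proof.
move=> m1; rewrite /coupling /hmean.
have := @alpha_ge1 m p m1; have := @alpha_ge1 m q m1.
move: (alpha H m p) (alpha H m q) => a c a1 c1.
by rewrite ler_pdivlMr; nra.
Qed.

Lemma K_rankE m p q : K H m (enum_rank p) (enum_rank q) = K_entry H m p q.
Proof. by rewrite mxE !enum_rankK. Qed.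

Lemma K_mulmxE m (v : 'cV[R]_#|cell N|) p :
  (K H m *m v) (enum_rank p) 0 = stencil m (fun q => v (enum_rank q) 0) p.
Proof.
rewrite mxE (reindex (@enum_rank (cell N))); last first.
  by exists enum_val => ? _; rewrite ?enum_rankK ?enum_valK.
under eq_bigr do rewrite K_rankE.
rewrite (bigD1 p)//= /stencil /K_entry eqxx mulrDl addrAC.
congr (_ + _).
rewrite [X in _ + X](eq_bigr (fun q => if cell_adj p q
  then - coupling H m p q * v (enum_rank q) 0 else 0)); last first.
  by move=> q /negPf qp; rewrite eq_sym qp; case: ifP; rewrite ?mul0r.
rewrite -big_mkcondr /= mulr_suml.
rewrite [X in _ + X](eq_bigl (cell_adj p)); last first.
  by move=> q; case: eqVneq => //= ->; rewrite cell_adjxx.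
by rewrite -big_split /=; apply: eq_bigr => q _; ring.
Qed.

(** Summation by parts: exchanging the endpoints of every ordered edge and adding both forms of the
    sum produces squared differences. Each edge is met twice, hence the factor one half in
    [energy]. *)
Lemma energyE m u : \sum_p u p * stencil m u p = energy m u.
Proof.
rewrite /stencil /energy.
under eq_bigr do rewrite mulrDr.
rewrite big_split /=; congr (_ + _); last first.
  by apply: eq_bigr => p _; ring.
under eq_bigr do rewrite mulr_sumr.
set S := LHS.
have SE : S = \sum_p \sum_(q | cell_adj p q)
    u q * (coupling H m p q * (u q - u p)).
  rewrite /S (exchange_big_dep predT) //=; apply: eq_bigr => p _.
  by apply: eq_big => [q|q _]; rewrite 1?cell_adjC// couplingC.
have SS : S + S = \sum_p \sum_(q | cell_adj p q)
    coupling H m p q * (u p - u q) ^+ 2.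
  rewrite {2}SE /S -big_split; apply: eq_bigr => p _ /=.
  by rewrite -big_split; apply: eq_bigr => q _ /=; ring.
by rewrite -SS; field.
Qed.

Lemma edge_energy_ge0 m u p q : 1 <= m ->
  0 <= coupling H m p q * (u p - u q) ^+ 2.
Proof.
by move=> /(coupling_ge1 m p q) c1; rewrite mulr_ge0 ?sqr_ge0// (le_trans _ c1).
Qed.

Lemma boundary_energy_ge0 m u p : 1 <= m ->
  0 <= 2 * alpha H m p * (boundary_edges p)%:R * u p ^+ 2.
Proof.
move=> /(alpha_ge1 m p) a1; apply: mulr_ge0 (sqr_ge0 _).
by apply: mulr_ge0 => //; lra.
Qed.

Lemma edge_energy_le m u p q : 1 <= m -> cell_adj p q ->
  coupling H m p q * (u p - u q) ^+ 2 <= 2 * energy m u.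
Proof.
move=> m1 pq; rewrite /energy mulrDr mulVKf//.
rewrite ler_wpDr ?mulr_ge0 ?sumr_ge0//.
  by move=> r _; exact: boundary_energy_ge0.
rewrite (bigD1 p)//= (bigD1 q)//= -addrA ler_wpDr// addr_ge0 ?sumr_ge0//.
  by move=> r _; exact: edge_energy_ge0.
by move=> r _; rewrite sumr_ge0// => s _; exact: edge_energy_ge0.
Qed.

Lemma boundary_energy_le m u p : 1 <= m -> (0 < boundary_edges p)%N ->
  u p ^+ 2 <= 2 * energy m u.
Proof.
move=> m1 pb; rewrite /energy mulrDr mulVKf//.
rewrite ler_wpDl//.
  by apply: sumr_ge0 => r _; apply: sumr_ge0 => s _; exact: edge_energy_ge0.
rewrite (bigD1 p)//= mulrDr ler_wpDr ?mulr_ge0 ?sumr_ge0//.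
  by move=> r _; exact: boundary_energy_ge0.
rewrite [leRHS]mulrA ler_peMl ?sqr_ge0//.
have := @alpha_ge1 m p m1.
have : 1 <= (boundary_edges p)%:R :> R by rewrite ler1n.
by nra.
Qed.

(* Walk from the boundary along a line of cells; each step changes u by at most
   the square root of twice the energy. *)
Lemma norm_le_energy m u p : 1 <= m ->
  `|u p| <= N%:R * Num.sqrt (2 * energy m u).
Proof.
move=> m1; set s := Num.sqrt _.
have le_s x : x ^+ 2 <= 2 * energy m u -> `|x| <= s.
  by move=> xE; rewrite -sqrtr_sqr ler_wsqrtr.
suff walk k : forall p, p.1 = k :> nat -> `|u p| <= k.+1%:R * s.
  rewrite (le_trans (walk _ p erefl))// ler_wpM2r ?sqrtr_ge0//.
  by rewrite ler_nat ltn_ord.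
elim: k => [|k IH] [i j] /= ik.
  rewrite mul1r le_s// boundary_energy_le//.
  by rewrite /boundary_edges /= ik.
have kN : (k < N)%N by rewrite -ltnS -ik ltnW// ltnS ltn_ord.
have := IH (Ordinal kN, j) erefl => {}IH.
rewrite -(subrK (u (Ordinal kN, j)) (u (i, j))) (le_trans (ler_normD _ _))//.
rewrite -[k.+2]addn1 natrD mulrDl mul1r addrC lerD// le_s//.
apply: le_trans (edge_energy_le m u (i, j) (Ordinal kN, j) m1 _); last first.
  by rewrite /cell_adj /= eqxx ik eqxx !orbT.
by rewrite ler_peMl ?sqr_ge0 ?coupling_ge1.
Qed.

(** With [s] the square root of twice the energy, the discrete Poincare bound gives
    [s ^+ 2 / 2 <= N s W]; cancelling one [s] leaves a bound by the data [W] alone, in which [m]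
    does not appear explicitly. *)
Lemma stencil_stable m u : 1 <= m ->
  let W := \sum_p `|stencil m u p| in
  (forall p, `|u p| <= N%:R * (2 * N%:R * W)) /\
  2 * energy m u <= (2 * N%:R * W) ^+ 2.
Proof.
move=> m1 W; set s := Num.sqrt (2 * energy m u).
have W0 : 0 <= W by apply: sumr_ge0.
have E0 : 0 <= energy m u.
  rewrite /energy addr_ge0 ?mulr_ge0 ?sumr_ge0//.
    by move=> p _; rewrite sumr_ge0// => q _; exact: edge_energy_ge0.
  by move=> p _; exact: boundary_energy_ge0.
have s0 : 0 <= s by exact: sqrtr_ge0.
have s2 : s ^+ 2 = 2 * energy m u by rewrite sqr_sqrtr ?mulr_ge0.
have EW : energy m u <= N%:R * s * W.
  rewrite -energyE (le_trans (ler_norm _))// (le_trans (ler_norm_sum _ _ _))//.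
  rewrite mulr_sumr ler_sum// => p _.
  by rewrite normrM ler_wpM2r// norm_le_energy.
have sW : s <= 2 * N%:R * W.
  have [->|sn0] := eqVneq s 0; first by rewrite !mulr_ge0.
  have sp : 0 < s by rewrite lt_neqAle eq_sym sn0.
  rewrite -(ler_pM2r sp) -expr2 s2.
  have -> : 2 * N%:R * W * s = 2 * (N%:R * s * W) by ring.
  by rewrite ler_pM2l.
split=> [p|]; first by rewrite (le_trans (norm_le_energy m u p m1))// ler_wpM2l.
by rewrite -s2 lerXn2r ?nnegrE// !mulr_ge0.
Qed.


(** * Unique solvability and rational dependence of the solution on [m] *)

Lemma det_K_neq0 m : 1 <= m -> \det (K H m) != 0.
Proof.
move=> m1; rewrite -det_tr; apply/det0P => -[v v0 vK].
have Kv : K H m *m v^T = 0 by rewrite -[K H m]trmxK -trmx_mul vK trmx0.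
have u0 p : stencil m (fun q => v^T (enum_rank q) 0) p = 0.
  by rewrite -K_mulmxE Kv mxE.
have [+ _] := stencil_stable m (fun q => v^T (enum_rank q) 0) m1.
rewrite big1 => [|p _]; last by rewrite u0 normr0.
rewrite !mulr0 => vle; move/eqP: v0; apply; apply/rowP => i; rewrite mxE.
have := vle (enum_val i); rewrite enum_valK mxE normr_le0 => /eqP.
by [].
Qed.

(** The coupling times [m + 1]: this single factor clears every denominator of the matrix, since
    only the H-L coupling [2m/(m+1)] has one. *)
Definition coupling_poly p q : {poly R} :=
  if p \in H then (if q \in H then 'X * ('X + 1) else 2 *: 'X)
  else (if q \in H then 2 *: 'X else 'X + 1).

Definition alpha_poly p : {poly R} := if p \in H then 'X else 1.

Definition K_poly : 'M[{poly R}]_#|cell N| :=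
  \matrix_(i, j)
    let p := enum_val i in let q := enum_val j in
    if p == q then
      \sum_(r | cell_adj p r) coupling_poly p r
      + 2 *: alpha_poly p * ('X + 1) * (boundary_edges p)%:R
    else if cell_adj p q then - coupling_poly p q else 0.

Lemma horner_coupling_poly m p q : 1 <= m ->
  (coupling_poly p q).[m] = (m + 1) * coupling H m p q.
Proof.
move=> m1; rewrite /coupling_poly /coupling /hmean /alpha.
by case: ifP => _; case: ifP => _; rewrite !hornerE /=; field; lra.
Qed.

Lemma horner_K_poly m : 1 <= m ->
  map_mx (horner_eval m) K_poly = (m + 1) *: K H m.
Proof.
move=> m1; apply/matrixP => i j; rewrite !mxE /horner_eval /= /K_entry.
case: ifP => _; last first.
  case: ifP => _; last by rewrite horner0 mulr0.
  by rewrite hornerN horner_coupling_poly// mulrN.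
rewrite hornerD horner_sum [RHS]mulrDr mulr_sumr; congr (_ + _).
  by apply: eq_bigr => r _; rewrite horner_coupling_poly.
rewrite -polyC_natr /alpha_poly /alpha.
by case: ifP => _; rewrite !hornerE; rewrite /=; ring.
Qed.

Lemma solution_limit (b : 'cV[R]_#|cell N|) (x : R -> 'cV[R]_#|cell N|) i :
  (forall m, 1 <= m -> K H m *m x m = b) ->
  exists l D : R, forall m, 1 <= m -> `|x m i 0 - l| <= D / m.
Proof.
move=> Kx.
(* Cramer numerator: the cleared system at [m] is [(m+1) K x = (m+1) b], and multiplying by the
   adjugate leaves the determinant times [x]. *)
pose P := (\adj K_poly *m (('X + 1) *: map_mx polyC b)) i 0.
apply: (@bounded_rational_limit _ P (\det K_poly) _
  (N%:R * (2 * N%:R * \sum_p `|b (enum_rank p) 0|))).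
(* Evaluating a zero determinant polynomial at 1 would make [2 *: K H 1] singular. *)
- apply/eqP => d0; have := det_K_neq0 1 (lexx _).
  have := det_map_mx (horner_eval (1 : R)) K_poly.
  rewrite horner_K_poly// d0 rmorph0 detZ => /eqP.
  rewrite mulf_eq0 expf_eq0 => /orP[/andP[_ /eqP]|->//]; lra.
- move=> m m1.
  have -> : P.[m] = (map_mx (horner_eval m)
      (\adj K_poly *m (('X + 1) *: map_mx polyC b))) i 0 by rewrite mxE.
  have -> : map_mx (horner_eval m) (\adj K_poly *m (('X + 1) *: map_mx polyC b))
      = \adj (map_mx (horner_eval m) K_poly)
        *m (map_mx (horner_eval m) K_poly *m x m).
    rewrite map_mxM map_mx_adj; congr (_ *m _).
    rewrite horner_K_poly// -scalemxAl Kx//.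
    by apply/matrixP => j k; rewrite !mxE /= /horner_eval !hornerE.
  by rewrite mulmxA mul_adj_mx mul_scalar_mx det_map_mx mxE.
- move=> m m1; have [+ _] := stencil_stable m (fun q => x m (enum_rank q) 0) m1.
  move=> /(_ (enum_val i)); rewrite enum_valK => /le_trans; apply.
  rewrite ler_wpM2l// ler_wpM2l ?mulr_ge0// ler_sum// => p _.
  by rewrite -K_mulmxE Kx.
Qed.

End Stencil.

(** * The limit on the island and its flux balance *)

Section Limit.
Context (R : realType) (N : nat) (H : {set cell N}).
Context (u : R -> cell N -> R) (w l D : cell N -> R).
Hypothesis u_stencil : forall m, 1 <= m -> stencil R N H m (u m) =1 w.
Hypothesis u_limit : forall m p, 1 <= m -> `|u m p - l p| <= D p / m.
Hypothesis H_interior : {in H, forall p, boundary_edges p = 0%N}.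

(** The coupling inside the island is exactly [m], so the uniform energy bound leaves a squared jump
    of size [O(1/m)] across the edge. *)
Lemma limit_eq_on_edges p q : p \in H -> q \in H -> cell_adj p q -> l p = l q.
Proof.
move=> pH qH pq; apply/eqP; rewrite -subr_eq0 -sqrf_eq0; apply/eqP.
pose C : R := (2 * N%:R * \sum_p `|w p|) ^+ 2.
apply: (@eq0_of_bounded_multiples _ _ (2 * (D p + D q) ^+ 2 + 2 * C)) => m m1.
have m0 : 0 < m by exact: lt_le_trans m1.
have uC : (u m p - u m q) ^+ 2 <= C / m.
  have [_] := stencil_stable R N H m (u m) m1.
  rewrite (eq_bigr (fun r => `|w r|)) => [EC|r _]; last by rewrite u_stencil.
  rewrite ler_pdivlMr// mulrC; apply: le_trans EC.
  apply: le_trans (edge_energy_le _ _ _ m (u m) p q m1 pq).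
  rewrite /coupling /hmean /alpha pH qH ler_wpM2r ?sqr_ge0//.
  by have -> : 2 * m * m / (m + m) = m by field; lra.
have Dm : (l p - l q - (u m p - u m q)) ^+ 2 <= (D p + D q) ^+ 2 / m.
  have d0 : 0 <= (D p + D q) / m.
    by rewrite mulrDl addr_ge0// (le_trans _ (u_limit m _ m1)).
  apply: le_trans (_ : ((D p + D q) / m) ^+ 2 <= _).
    rewrite -[leLHS]real_normK ?num_real// lerXn2r ?nnegrE//.
    have -> : l p - l q - (u m p - u m q) = (u m q - l q) - (u m p - l p)
      by ring.
    rewrite (le_trans (ler_normB _ _))// addrC [leRHS]mulrDl.
    by rewrite lerD ?u_limit.
  (* The rate [1/m^2] is weakened to [1/m] to match that of [uC]. *)
  rewrite exprMn ler_wpM2l ?sqr_ge0// expr2 ler_piMl ?invr_ge0 ?(ltW m0)//.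
  by rewrite invf_le1.
rewrite ger0_norm ?sqr_ge0//.
have -> : (2 * (D p + D q) ^+ 2 + 2 * C) / m =
  2 * ((D p + D q) ^+ 2 / m) + 2 * (C / m) by ring.
move: uC Dm; move: (C / m) (_ ^+ 2 / m) (u m p - u m q) (l p - l q).
(* This square is the gap in [a^2 <= 2 (a - v)^2 + 2 v^2]. *)
by move=> c d v a; have := sqr_ge0 (a - 2 * v); nra.
Qed.

Lemma limit_constant p q : edge_connected H -> p \in H -> q \in H -> l p = l q.
Proof.
move=> Hc pH qH; have /connectP[s] := Hc _ _ pH qH.
elim: s p {pH} => [|r s IH] p /=; first by move=> _ ->.
move=> /andP[/and3P[pH rH pr] rs] qE.
by rewrite (limit_eq_on_edges _ _ pH rH pr); apply: IH.
Qed.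

Lemma island_flux m : 1 <= m ->
  \sum_(p in H) w p = 2 * m / (m + 1) *
    \sum_(p in H) \sum_(q | cell_adj p q && (q \notin H)) (u m p - u m q).
Proof.
move=> m1; have m0 : 0 < m by exact: lt_le_trans m1.
pose F p q := coupling H m p q * (u m p - u m q).
have FE p : p \in H -> w p = \sum_(q | cell_adj p q && (q \in H)) F p q
    + \sum_(q | cell_adj p q && (q \notin H)) F p q.
  move=> pH; rewrite -(u_stencil m m1) /stencil H_interior// mulr0 mul0r addr0.
  by rewrite (bigID (mem H)).
rewrite (eq_bigr _ FE) big_split /=.
set S := \sum_(p in H) _.
(* Fluxes between two island cells are antisymmetric, so their total cancels. *)
have S0 : S = - S.
  rewrite {1}/S (exchange_big_dep (mem H)) /=; last by move=> p q _ /andP[].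
  rewrite -sumrN; apply: eq_bigr => p pH; rewrite -sumrN.
  apply: eq_big => [q|q _]; first by rewrite cell_adjC pH andbT andbC.
  by rewrite /F couplingC -mulrN opprB.
have -> : S = 0 by move: S0; lra.
rewrite add0r mulr_sumr; apply: eq_bigr => p pH; rewrite mulr_sumr.
apply: eq_bigr => q /andP[_ qH].
by rewrite /F /coupling /hmean /alpha pH (negPf qH) mulr1.
Qed.

Lemma limit_flux :
  \sum_(p in H) w p =
  2 * \sum_(p in H) \sum_(q | cell_adj p q && (q \notin H)) (l p - l q).
Proof.
set W := LHS; set S := \sum_(p in H) _.
pose B := \sum_(p in H) \sum_(q | cell_adj p q && (q \notin H)) (D p + D q).
suff -> : S = W / 2 by field.
apply/eqP; rewrite -subr_eq0; apply/eqP.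
apply: (@eq0_of_bounded_multiples _ _ (B + `|W| / 2)) => m m1.
have m0 : 0 < m by exact: lt_le_trans m1.
pose Sm :=
  \sum_(p in H) \sum_(q | cell_adj p q && (q \notin H)) (u m p - u m q).
(* Solving the island balance for [Sm] gives exactly [W (m+1) / (2m)]. *)
have SW : Sm - W / 2 = W / 2 / m.
  rewrite [W in LHS](island_flux m m1) [W](island_flux m m1) -/Sm.
  by field; lra.
have SS : `|Sm - S| <= B / m.
  rewrite /Sm /S /B mulr_suml -sumrB (le_trans (ler_norm_sum _ _ _))//.
  rewrite ler_sum// => p _.
  rewrite mulr_suml -sumrB (le_trans (ler_norm_sum _ _ _))// ler_sum// => q _.
  have -> : u m p - u m q - (l p - l q) = (u m p - l p) - (u m q - l q) by ring.
  by rewrite (le_trans (ler_normB _ _))// [leRHS]mulrDl lerD ?u_limit.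
have -> : S - W / 2 = (Sm - W / 2) - (Sm - S) by ring.
rewrite (le_trans (ler_normB _ _))// addrC [leRHS]mulrDl lerD// SW.
rewrite !normrM [`|m^-1|]ger0_norm ?invr_ge0 ?(ltW m0)//.
by rewrite (ger0_norm (_ : 0 <= 2^-1 :> R)).
Qed.

End Limit.

(** * The interface count and the island coefficient *)

Lemma interface_edgesE (R : realType) (N : nat) (H : {set cell N}) :
  (interface_edges H)%:R =
  \sum_(p in H) \sum_(q | cell_adj p q && (q \notin H)) 1 :> R.
Proof.
rewrite /interface_edges -sum1_card natr_sum.
rewrite pair_big_dep /=; apply: eq_bigl => -[p q] /=.
by rewrite inE /= [(q \notin H) && _]andbC.
Qed.

Lemma eta_gt0 (R : realType) (N : nat) (H : {set cell N}) :
  H != finset.set0 -> {in H, forall p, boundary_edges p = 0%N} ->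
  0 < eta R H.
Proof.
move=> /set0Pn[p0 p0H] Hin.
have n0 : (0 < #|H|)%N by apply/card_gt0P; exists p0.
rewrite /eta divr_gt0 ?ltr0n// mulr_gt0// ltr0n.
(* An island cell with largest first coordinate is off the boundary, so it has a next neighbour,
   which lies outside [H] by maximality: an interface edge. *)
case: (@arg_maxnP _ p0 (mem H) (fun p : cell N => p.1 : nat) p0H).
move=> -[i j] ijH pmax.
have pH : (i, j) \in H by [].
have := Hin _ pH; rewrite /boundary_edges /= => /eqP.
rewrite !addn_eq0 !eqb0 => /andP[/andP[/andP[_ iN] _] _].
have i1N : (i.+1 < N)%N by rewrite ltn_neqAle iN ltn_ord.
apply/card_gt0P; exists ((i, j), (Ordinal i1N, j)); rewrite inE /= pH /=.
apply/andP; split; last by rewrite /cell_adj /= !eqxx /= orbT.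
by apply/negP => /pmax /=; rewrite ltnn.
Qed.

(** Passing from enumerated blocks to sums over cells lets [limit_flux] be substituted directly. *)
Lemma island_coefficientE (R : realType) (N : nat) (H : {set cell N})
    (b : 'cV[R]_#|cell N|) (l : cell N -> R) :
  island_coefficient (part H b) (\col_(i < #|~: H|) l (enum_val i)) =
  (eta R H)^-1 * (Num.sqrt #|H|%:R)^-1 *
  (\sum_(p in H) b (enum_rank p) 0
   + 2 * \sum_(p in H) \sum_(q | cell_adj p q && (q \notin H)) l q).
Proof.
rewrite /island_coefficient -mulrA; congr (_ * _).
rewrite mxE mulr_sumr -big_split /= mulr_sumr [RHS]big_enum_val.
apply: eq_bigr => i _; rewrite !mxE; congr (_ * (_ + _)).
rewrite -sumrN mulr_sumr.
rewrite [RHS](eq_bigl (fun q => (q \in ~: H) && cell_adj (enum_val i) q));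
  last by move=> q; rewrite inE andbC.
rewrite big_mkcondr /= [RHS]big_enum_val; apply: eq_bigr => j _.
by rewrite !mxE; case: ifP; rewrite ?mul0r ?oppr0// mulNr opprK.
Qed.

Lemma mx_norm_le (R : realType) (k n : nat) (A : 'M[R]_(k, n)) (c : R) :
  0 <= c -> (forall i j, `|A i j| <= c) -> `|A| <= c.
Proof.
by move=> c0 Ac; rewrite [leLHS]/Num.Def.normr/= mx_normrE (bigmax_le _ c0).
Qed.

Lemma cvgy_of_rate (R : realType) (V : normedModType R) (f : R -> V) (a : V)
    (D : R) :
  (forall m, 1 <= m -> `|f m - a| <= D / m) -> f m @[m --> +oo] --> a.
Proof.
move=> fD; apply/cvgrPdist_le => e e0; near=> m.
have m1 : 1 <= m by near: m; exact: nbhs_pinfty_ge.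
have m0 : 0 < m by exact: lt_le_trans m1.
rewrite distrC (le_trans (fD m m1))// ler_pdivrMr// mulrC -ler_pdivrMr//.
Unshelve. all: by end_near. Qed.

(** * Assembly of the asymptotics *)

Theorem lemma4 (R : realType) (N : nat) (H : {set cell N})
  (b : 'cV[R]_#|cell N|) (x : R -> 'cV[R]_#|cell N|)
  (H_nonempty : H != finset.set0)
  (H_connected : edge_connected H)
  (H_interior : {in H, forall p, boundary_edges p = 0%N})
  (x_solution : forall m : R, 1 <= m -> K H m *m x m = b) :
  exists (cH : R) (xL : 'cV[R]_#|~: H|),
    [/\ part (~: H) (x m) @[m --> +oo] --> xL,
        0 < eta R H,
        cH = island_coefficient (part H b) xL
      & (fun m : R => part H (x m)) =
          (fun=> cH *: e_ R H) +O_ +oo (fun m : R => m^-1 : R^o)].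
Proof.
have /choice[l /choice[D lD]] := fun p : cell N =>
  solution_limit R N H b x (enum_rank p) x_solution.
have u_limit m p (m1 : 1 <= m) : `|x m (enum_rank p) 0 - l p| <= D p / m
  by exact: lD.
have u_stencil m (m1 : 1 <= m) :
    stencil R N H m (fun q => x m (enum_rank q) 0) =1
    (fun p => b (enum_rank p) 0).
  by move=> p; rewrite -K_mulmxE x_solution.
have D0 p : 0 <= D p.
  by have := u_limit 1 p (lexx _); rewrite divr1; apply: le_trans.
(* One constant dominating the finitely many entrywise ones, valid on both regions. *)
pose C := \sum_p D p.
have DC p : D p <= C by rewrite /C (bigD1 p)//= lerDl sumr_ge0.
have C0 : 0 <= C by exact: sumr_ge0.
have part_limit (A : {set cell N}) m : 1 <= m ->
    `|part A (x m) - \col_(i < #|A|) l (enum_val i)| <= C / m.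
  move=> m1; have m0 : 0 < m by exact: lt_le_trans m1.
  apply: mx_norm_le => [|i j]; first by rewrite divr_ge0// ltW.
  rewrite !mxE (le_trans (u_limit m _ m1))// ler_wpM2r ?invr_ge0 ?(ltW m0)//.
have [p0 p0H] := set0Pn _ H_nonempty.
have l_const p : p \in H -> l p = l p0.
  move=> pH; exact: (limit_constant R N H _ _ l D u_stencil u_limit).
have n0 : 0 < #|H|%:R :> R by rewrite ltr0n; apply/card_gt0P; exists p0.
have s0 : Num.sqrt #|H|%:R != 0 :> R by rewrite gt_eqF// sqrtr_gt0.
have eta0 : 0 < eta R H by exact: eta_gt0.
have i0 : (interface_edges H)%:R != 0 :> R.
  by apply: contraTneq eta0 => i0; rewrite /eta i0 mulr0 mul0r ltxx.
(* By the flux balance and constancy of [l] on [H], the bracket equals twice the interface count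
   times [l p0]. Dividing by [eta] leaves [#|H|], which the normalisation of [e_] reduces to its
   square root. *)
have cHE : island_coefficient (part H b) (\col_(i < #|~: H|) l (enum_val i))
    = l p0 * Num.sqrt #|H|%:R.
  rewrite island_coefficientE.
  rewrite (limit_flux R N H _ _ l D u_stencil u_limit H_interior).
  rewrite -mulrDr -big_split /=.
  rewrite (eq_bigr (fun p => l p0 *
    \sum_(q | cell_adj p q && (q \notin H)) 1)); last first.
    move=> p pH; rewrite -big_split mulr_sumr /=; apply: eq_bigr => q _.
    by rewrite subrK mulr1 l_const.
  rewrite -mulr_sumr -interface_edgesE /eta.
  rewrite -[X in _ / X](@sqr_sqrtr _ #|H|%:R) ?ltW//.
  by field; rewrite i0 s0.
exists (l p0 * Num.sqrt #|H|%:R), (\col_(i < #|~: H|) l (enum_val i)).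
split => //.
  exact: (cvgy_of_rate _ _ _ _ C (part_limit (~: H))).
have eE : (l p0 * Num.sqrt #|H|%:R) *: e_ R H = \col_(i < #|H|) l (enum_val i).
  by apply/colP => i; rewrite !mxE mulfK// l_const// enum_valP.
apply/eqaddOP; near=> k; near=> m.
have m1 : 1 <= m by near: m; exact: nbhs_pinfty_ge.
rewrite /= eE (le_trans (part_limit H m m1))//.
rewrite [`|m^-1|]ger0_norm ?invr_ge0 ?(le_trans _ m1)// ler_wpM2r//.
  by rewrite invr_ge0 (le_trans _ m1).
Unshelve. all: by end_near. Qed.
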